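(* Let $n\ge 2$, let $h\mathcal F=\{F\in\mathcal F\mid F_1(F)=F_2(F)=0\}$ (equivalently, $F=hF$), and let $\mathcal F_9=\{F\in\mathcal F\mid F=hF=F_9(F)\}$, $\mathcal F_{10}=\{F\in\mathcal F\mid F=hF=F_{10}(F)-F_9(F)\}$, $\mathcal F_{11}=\{F\in\mathcal F\mid F=hF=F_{11}(F)\}$, $\mathcal F_{12}=\{F\in\mathcal F\mid F=hF=F_{12}(F)-F_{11}(F)\}$. Then $$h\mathcal F=\mathcal F_9\oplus\mathcal F_{10}\oplus\mathcal F_{11}\oplus\mathcal F_{12}.$$ This decomposition is orthogonal and invariant under the action of $U(n)\times 1$. The components of $F\in h\mathcal F$ in $\mathcal F_9,\mathcal F_{10},\mathcal F_{11},\mathcal F_{12}$ are respectively $$F_9(F),\quad F_{10}(F)-F_9(F),\quad F_{11}(F),\quad F_{12}(F)-F_{11}(F).$$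
   Context: Let $V$ be a $(2n+1)$-dimensional real vector space with an almost contact metric structure $(\varphi,\xi,\eta,g)$: $\varphi$ is an endomorphism of $V$, $\xi\in V$, $\eta\in V^*$, $g$ is a positive definite inner product, and for all $x,y\in V$: $\varphi^2x=-x+\eta(x)\xi$, $\varphi(\xi)=0$, $\eta\circ\varphi=0$, $g(\xi,\xi)=1$, $g(\varphi x,\varphi y)=g(x,y)-\eta(x)\eta(y)$. Put $hx=-\varphi^2x$. $\mathcal F$ is the subspace of $V^*\otimes V^*\otimes V^*$ of all trilinear forms $F$ with $F(x,y,z)=-F(x,z,y)=-F(x,\varphi y,\varphi z)+\eta(y)F(x,\xi,z)+\eta(z)F(x,y,\xi)$ for all $x,y,z\in V$. It carries the inner product $\langle F',F''\rangle=\sum_{i,j,k}F'(e_i,e_j,e_k)F''(e_i,e_j,e_k)$, where $\{e_i\}$ is an orthonormal basis of $V$. $U(n)\times 1$ denotes the group of linear automorphisms of $V$ preserving $(\varphi,\xi,\eta,g)$; it acts on $\mathcal F$ by $(aF)(x,y,z)=F(a^{-1}x,a^{-1}y,a^{-1}z)$. For $F\in\mathcal F$ put $f(F)(z)=\sum_iF(e_i,e_i,z)$, $hF(x,y,z)=F(hx,hy,hz)$, $F_1(F)(x,y,z)=\eta(x)F(\xi,y,z)$, $F_2(F)(x,y,z)=\eta(y)F(x,\xi,z)-\eta(z)F(x,\xi,y)$. For $F\in h\mathcal F$ the following are elements of $h\mathcal F$ (the operators $F_i(\cdot)$ are distinct from the subspaces $\mathcal F_i$): $F_9(F)(x,y,z)=\frac1{2(n-1)}\{g(hx,hy)f(F)(z)-g(hx,hz)f(F)(y)-g(x,\varphi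 y)f(F)(\varphi z)+g(x,\varphi z)f(F)(\varphi y)\}$; $F_{10}(F)(x,y,z)=\frac12\{F(x,y,z)+F(\varphi x,\varphi y,z)\}$; $F_{11}(F)(x,y,z)=\frac16\{F(x,y,z)+F(y,z,x)+F(z,x,y)-F(\varphi x,\varphi y,z)-F(\varphi y,\varphi z,x)-F(\varphi z,\varphi x,y)\}$; $F_{12}(F)(x,y,z)=\frac12\{F(x,y,z)-F(\varphi x,\varphi y,z)\}$. *)

(* Defs.v *)
From HB Require Import structures.
From mathcomp Require Import all_boot all_order all_algebra.
From mathcomp Require Import ring.
From mathcomp Require Import boolp classical_sets reals.

Set Implicit Arguments.
Unset Strict Implicit.
Unset Printing Implicit Defensive.

Import Order.TTheory GRing.Theory Num.Theory.
Local Open Scope ring_scope.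

(* [{vspace vT}] has no comprehension: this is the subspace whose elements are
   the vectors satisfying [P], for [P] closed under linear combinations
   (see [mem_vspace_of]). *)
Definition vspace_of (K : fieldType) (vT : vectType K) (P : vT -> Prop) :
    {vspace vT} :=
  xget 0%VS [set U : {vspace vT} | forall v, v \in U <-> P v]%classic.

Lemma mem_vspace_of (K : fieldType) (vT : vectType K) (P : vT -> Prop) :
  P 0 -> (forall a u v, P u -> P v -> P (a *: u + v)) ->
  forall v, v \in vspace_of P <-> P v.
Proof.
move=> P0 PL; rewrite /vspace_of.
suff [U HU] : exists U : {vspace vT}, forall v, v \in U <-> P v.
  by case: xgetP => [W _ //|/(_ U) []].
pose Q (U : {vspace vT}) := forall v, v \in U -> P v.
pose q k := `[< exists U, Q U /\ \dim U = k >].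
have exq : exists k, q k.
  by exists 0; apply/asboolP; exists 0%VS; split; rewrite ?dimv0 // => v;
     rewrite memv0 => /eqP ->.
have ubq k : q k -> (k <= \dim {:vT})%N.
  by move=> /asboolP [U [_ <-]]; exact/dimvS/subvf.
case: (ex_maxnP exq ubq) => k /asboolP [U [QU dU]] kmax.
exists U => v; split=> [/QU //|Pv]; apply: contrapT => /negP vU.
have /kmax : q (\dim (U + <[v]>)).
  apply/asboolP; exists (U + <[v]>)%VS; split=> // w.
  move=> /memv_addP [u uU [_ /vlineP [a ->] ->]].
  by rewrite addrC; apply: PL => //; exact: QU.
rewrite -dU leqNgt => /negP; apply.
rewrite ltn_neqAle dimvS ?addvSl // andbT; apply/eqP => eq_d.
have /eqP eqU : (U == U + <[v]>)%VS by rewrite eqEdim addvSl /= -eq_d leqnn.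
by move: vU; rewrite eqU (subvP (addvSr U <[v]>%VS)) // memv_line.
Qed.

Lemma linfun_linE (K : fieldType) (aT rT : vectType K) (f : aT -> rT) :
  linear f -> linfun f =1 f.
Proof.
move=> lf; pose ff := HB.pack_for {linear aT -> rT} f
  (GRing.isLinear.Build _ _ _ _ f lf).
exact: (lfunE ff).
Qed.

(* V^* (x) V^* (x) V^*, in curried form; [F x y z] is the value of [F]. *)
Definition trilinear_form (R : realType) (V : vectType R) : Type :=
  'Hom(V, 'Hom(V, 'Hom(V, R^o))).

HB.instance Definition _ (R : realType) (V : vectType R) :=
  Vector.on (trilinear_form V).

Definition form_value (R : realType) (V : vectType R)
    (F : trilinear_form V) (x y z : V) : R :=
  (F : 'Hom(V, 'Hom(V, 'Hom(V, R^o)))) x y z.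
Coercion form_value : trilinear_form >-> Funclass.

(* The form with values [F x y z]; [F] is trilinear wherever this is used. *)
Definition trilin (R : realType) (V : vectType R) (F : V -> V -> V -> R) :
    trilinear_form V :=
  linfun (fun x => linfun (fun y => linfun (F x y : V -> R^o))).

Definition is_trilinear (R : realType) (V : vectType R)
    (F : V -> V -> V -> R) : Prop :=
  [/\ forall y z a u v, F (a *: u + v) y z = a * F u y z + F v y z,
      forall x z a u v, F x (a *: u + v) z = a * F x u z + F x v z &
      forall x y a u v, F x y (a *: u + v) = a * F x y u + F x y v].

Lemma trilinE (R : realType) (V : vectType R) (F : V -> V -> V -> R) :
  is_trilinear F -> forall x y z, trilin F x y z = F x y z.
Proof.
case=> l1 l2 l3.
have E3 x y z : linfun (F x y : V -> R^o) z = F x y z.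
  by rewrite linfun_linE // => a u v; exact: l3.
have E2 x y z : linfun (fun y => linfun (F x y : V -> R^o)) y z = F x y z.
  rewrite linfun_linE ?E3 // => a u v; apply/lfunP => w.
  by rewrite add_lfunE scale_lfunE !E3 l2.
move=> x y z; rewrite /form_value /trilin linfun_linE ?E2 // => a u v.
apply/lfunP => w; apply/lfunP => t.
by rewrite !(add_lfunE, scale_lfunE) !E2 l1.
Qed.

Record almost_contact_metric (R : realType) (V : vectType R) := {
  phi : 'End(V);
  xi : V;
  eta : 'Hom(V, R^o);
  met : {dot V for idfun};
  phi2E : forall x, phi (phi x) = - x + eta x *: xi;
  phi_xi : phi xi = 0;
  eta_phi : forall x, eta (phi x) = 0;
  met_xi : met xi xi = 1;
  met_phi : forall x y, met (phi x) (phi y) = met x y - eta x * eta y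
}.

Section Spaces.
Context (R : realType) (V : vectType R) (S : almost_contact_metric V).
Local Notation phi := (phi S).
Local Notation xi := (xi S).
Local Notation eta := (eta S).
Local Notation g := (met S).
Local Notation form := (trilinear_form V).
Implicit Types F G : form.

Definition hor (x : V) : V := - phi (phi x).

Definition spaceF : {vspace form} := vspace_of (fun F => forall x y z,
  F x y z = - F x z y /\
  F x y z = - F x (phi y) (phi z) + eta y * F x xi z + eta z * F x y xi).

Definition hF F : form := trilin (fun x y z => F (hor x) (hor y) (hor z)).
Definition F1 F : form := trilin (fun x y z => eta x * F xi y z).
Definition F2 F : form :=
  trilin (fun x y z => eta y * F x xi z - eta z * F x xi y).

Definition F10 F : form :=
  trilin (fun x y z => 2^-1 * (F x y z + F (phi x) (phi y) z)).
Definition F11 F : form := trilin (fun x y z => 6^-1 *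
  (F x y z + F y z x + F z x y
   - F (phi x) (phi y) z - F (phi y) (phi z) x - F (phi z) (phi x) y)).
Definition F12 F : form :=
  trilin (fun x y z => 2^-1 * (F x y z - F (phi x) (phi y) z)).

Definition space_hF : {vspace form} :=
  vspace_of (fun F => [/\ F \in spaceF, F1 F = 0 & F2 F = 0]).
Definition space11 : {vspace form} :=
  vspace_of (fun F => [/\ F \in spaceF, F = hF F & F = F11 F]).
Definition space12 : {vspace form} :=
  vspace_of (fun F => [/\ F \in spaceF, F = hF F & F = F12 F - F11 F]).

(* The group U(n) x 1, as the structure-preserving invertible maps. *)
Definition preserves_structure (a : 'End(V)) : Prop :=
  [/\ lker a == 0%VS, forall x, a (phi x) = phi (a x), a xi = xi,
      forall x, eta (a x) = eta x & forall x y, g (a x) (a y) = g x y].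

Definition act (a : 'End(V)) F : form :=
  trilin (fun x y z => F ((a^-1)%VF x) ((a^-1)%VF y) ((a^-1)%VF z)).

Definition orthonormal_basis m (e : m.-tuple V) : Prop :=
  basis_of fullv e /\ orthonormal g e.

(* [e] is an orthonormal basis; the traces below are computed in it. *)
Context (n : nat) (e : (n.*2.+1).-tuple V).

Definition trF F (z : V) : R := \sum_(i < n.*2.+1) F e`_i e`_i z.

Definition inner F G : R :=
  \sum_(i < n.*2.+1) \sum_(j < n.*2.+1) \sum_(k < n.*2.+1)
    F e`_i e`_j e`_k * G e`_i e`_j e`_k.

Definition F9 F : form := trilin (fun x y z => (2 * (n%:R - 1))^-1 *
  (g (hor x) (hor y) * trF F z - g (hor x) (hor z) * trF F y
   - g x (phi y) * trF F (phi z) + g x (phi z) * trF F (phi y))).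

Definition space9 : {vspace form} :=
  vspace_of (fun F => [/\ F \in spaceF, F = hF F & F = F9 F]).
Definition space10 : {vspace form} :=
  vspace_of (fun F => [/\ F \in spaceF, F = hF F & F = F10 F - F9 F]).

Definition orthogonal_spaces (U W : {vspace form}) : Prop :=
  {in U & W, forall F G, inner F G = 0}.

Definition invariant_space (U : {vspace form}) : Prop :=
  forall a, preserves_structure a -> {in U, forall F, act a F \in U}.

Lemma formP F G : (forall x y z, F x y z = G x y z) -> F = G.
Proof. by move=> eFG; do 3!apply/lfunP=> ?; exact: eFG. Qed.

Lemma formDZ a F G x y z : (a *: F + G : form) x y z = a * F x y z + G x y z.
Proof. by rewrite /form_value !(add_lfunE, scale_lfunE). Qed.

Lemma form0 x y z : (0 : form) x y z = 0.
Proof. by rewrite /form_value !zero_lfunE. Qed.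

Lemma form_trilinear F : is_trilinear F.
Proof.
split=> x y a u v; rewrite /form_value linearP //.
  by rewrite !(add_lfunE, scale_lfunE).
by rewrite add_lfunE scale_lfunE.
Qed.

Lemma form_l1 F a u v y z : F (a *: u + v) y z = a * F u y z + F v y z.
Proof. by case: (form_trilinear F). Qed.

Lemma form_l2 F a u v x z : F x (a *: u + v) z = a * F x u z + F x v z.
Proof. by case: (form_trilinear F). Qed.

Lemma form_l3 F a u v x y : F x y (a *: u + v) = a * F x y u + F x y v.
Proof. by case: (form_trilinear F). Qed.

Lemma eta_l a u v : eta (a *: u + v) = a * eta u + eta v :> R.
Proof. by rewrite linearP. Qed.

Lemma met_l1 a u v x : g (a *: u + v) x = a * g u x + g v x :> R.
Proof. by rewrite linearPl. Qed.

Lemma met_l2 a u v x : g x (a *: u + v) = a * g x u + g x v :> R.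
Proof. by rewrite linearPr. Qed.

Lemma hor_l a u v : hor (a *: u + v) = a *: hor u + hor v.
Proof. by rewrite /hor !linearP. Qed.

Lemma phi_l a u v : phi (a *: u + v) = a *: phi u + phi v.
Proof. by rewrite linearP. Qed.

Lemma trF_l F a u v : trF F (a *: u + v) = a * trF F u + trF F v.
Proof.
rewrite /trF mulr_sumr -big_split; apply: eq_bigr => i _.
by rewrite form_l3.
Qed.

Lemma inv_l (b : 'End(V)) a u v :
  (b^-1)%VF (a *: u + v) = a *: (b^-1)%VF u + (b^-1)%VF v.
Proof. by rewrite linearP. Qed.

Let lE := (hor_l, phi_l, inv_l, trF_l, form_l1, form_l2, form_l3, eta_l,
           met_l1, met_l2).

Local Ltac trilinear := split=> ? ? ? ? ?; rewrite !lE; ring.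

Lemma hFE F x y z : hF F x y z = F (hor x) (hor y) (hor z).
Proof. by rewrite trilinE //; trilinear. Qed.

Lemma F1E F x y z : F1 F x y z = eta x * F xi y z.
Proof. by rewrite trilinE //; trilinear. Qed.

Lemma F2E F x y z : F2 F x y z = eta y * F x xi z - eta z * F x xi y.
Proof. by rewrite trilinE //; trilinear. Qed.

Lemma F9E F x y z : F9 F x y z = (2 * (n%:R - 1))^-1 *
  (g (hor x) (hor y) * trF F z - g (hor x) (hor z) * trF F y
   - g x (phi y) * trF F (phi z) + g x (phi z) * trF F (phi y)).
Proof. by rewrite trilinE //; trilinear. Qed.

Lemma F10E F x y z : F10 F x y z = 2^-1 * (F x y z + F (phi x) (phi y) z).
Proof. by rewrite trilinE //; trilinear. Qed.

Lemma F11E F x y z : F11 F x y z = 6^-1 *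
  (F x y z + F y z x + F z x y
   - F (phi x) (phi y) z - F (phi y) (phi z) x - F (phi z) (phi x) y).
Proof. by rewrite trilinE //; trilinear. Qed.

Lemma F12E F x y z : F12 F x y z = 2^-1 * (F x y z - F (phi x) (phi y) z).
Proof. by rewrite trilinE //; trilinear. Qed.

Lemma actE (a : 'End(V)) F x y z :
  act a F x y z = F ((a^-1)%VF x) ((a^-1)%VF y) ((a^-1)%VF z).
Proof. by rewrite trilinE //; trilinear. Qed.

Lemma trF_lin a F G z : trF (a *: F + G) z = a * trF F z + trF G z.
Proof.
rewrite /trF mulr_sumr -big_split; apply: eq_bigr => i _.
by rewrite formDZ.
Qed.

Local Ltac form_linear E :=
  match goal with |- ?op (?a *: ?F + ?G) = _ =>
    let H := fresh in let HE := fresh in let TE := fresh in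
    have HE := formDZ a F G; have TE := trF_lin a F G;
    move: (a *: F + G) HE TE => H HE TE;
    apply: formP => x y z; rewrite [RHS]formDZ !E ?HE ?TE; ring
  end.

Lemma hF_lin a F G : hF (a *: F + G) = a *: hF F + hF G.
Proof. form_linear hFE. Qed.
Lemma F1_lin a F G : F1 (a *: F + G) = a *: F1 F + F1 G.
Proof. form_linear F1E. Qed.
Lemma F2_lin a F G : F2 (a *: F + G) = a *: F2 F + F2 G.
Proof. form_linear F2E. Qed.
Lemma F9_lin a F G : F9 (a *: F + G) = a *: F9 F + F9 G.
Proof. form_linear F9E. Qed.
Lemma F10_lin a F G : F10 (a *: F + G) = a *: F10 F + F10 G.
Proof. form_linear F10E. Qed.
Lemma F11_lin a F G : F11 (a *: F + G) = a *: F11 F + F11 G.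
Proof. form_linear F11E. Qed.
Lemma F12_lin a F G : F12 (a *: F + G) = a *: F12 F + F12 G.
Proof. form_linear F12E. Qed.

Lemma lin0 (op : form -> form) :
  (forall a F G, op (a *: F + G) = a *: op F + op G) -> op 0 = 0.
Proof.
by move=> /(_ (-1) 0 0); rewrite scaler0 addr0 scaleN1r addNr.
Qed.

Lemma spaceFP F : F \in spaceF <-> forall x y z,
  F x y z = - F x z y /\
  F x y z = - F x (phi y) (phi z) + eta y * F x xi z + eta z * F x y xi.
Proof.
apply: mem_vspace_of => [x y z|a A B PA PB x y z].
  by rewrite !form0 !mulr0 oppr0 !addr0.
rewrite !formDZ; have [A1 A2] := PA x y z; have [B1 B2] := PB x y z.
by split; [rewrite A1 B1|rewrite A2 B2]; ring.
Qed.

Lemma space_hFP F :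
  F \in space_hF <-> [/\ F \in spaceF, F1 F = 0 & F2 F = 0].
Proof.
apply: mem_vspace_of => [|a A B [A0 A1 A2] [B0 B1 B2]].
  by rewrite mem0v (lin0 F1_lin) (lin0 F2_lin).
by split; rewrite ?F1_lin ?F2_lin ?A1 ?A2 ?B1 ?B2 ?scaler0 ?addr0 //
  rpredD ?rpredZ.
Qed.

Lemma fix_spaceP (op : form -> form) :
  (forall a F G, op (a *: F + G) = a *: op F + op G) -> forall F,
  F \in vspace_of (fun F => [/\ F \in spaceF, F = hF F & F = op F]) <->
  [/\ F \in spaceF, F = hF F & F = op F].
Proof.
move=> opl; apply: mem_vspace_of => [|a A B [A0 A1 A2] [B0 B1 B2]].
  by rewrite mem0v (lin0 hF_lin) (lin0 opl).
by split; rewrite ?hF_lin ?opl -?A1 -?A2 -?B1 -?B2 // rpredD ?rpredZ.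
Qed.

Lemma space9P F :
  F \in space9 <-> [/\ F \in spaceF, F = hF F & F = F9 F].
Proof. exact: (fix_spaceP F9_lin). Qed.

Lemma space10P F :
  F \in space10 <-> [/\ F \in spaceF, F = hF F & F = F10 F - F9 F].
Proof.
apply: (@fix_spaceP (fun F => F10 F - F9 F)) => a A B.
by rewrite F10_lin F9_lin scalerBr opprD addrACA.
Qed.

Lemma space11P F :
  F \in space11 <-> [/\ F \in spaceF, F = hF F & F = F11 F].
Proof. exact: (fix_spaceP F11_lin). Qed.

Lemma space12P F :
  F \in space12 <-> [/\ F \in spaceF, F = hF F & F = F12 F - F11 F].
Proof.
apply: (@fix_spaceP (fun F => F12 F - F11 F)) => a A B.
by rewrite F12_lin F11_lin scalerBr opprD addrACA.
Qed.

End Spaces.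

(* Main.v *)
Require Import Defs.
From HB Require Import structures.
From mathcomp Require Import all_boot all_order all_algebra.
From mathcomp Require Import ring lra.
From mathcomp Require Import boolp classical_sets reals.

Set Implicit Arguments.
Unset Strict Implicit.
Unset Printing Implicit Defensive.

Import Order.TTheory GRing.Theory Num.Theory.
Local Open Scope ring_scope.

(** Every operator in the statement is built from one involution. A horizontal
    form ([F = hF F] in [spaceF]) vanishes as soon as one argument is [xi], is
    skew in its last two arguments, and satisfies
    [F x (phi y) z = F x y (phi z)]. On such forms [phi] squares to [-1] in
    every slot, so [(L F) x y z = F (phi x) (phi y) z] is an involution of
    [h F], and [F10], [F12] are the projections [(1 + L) / 2], [(1 - L) / 2]
    onto its eigenspaces, the even and the odd forms.

    On odd forms, where [phi] moves freely between the three slots, averaging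
    over cyclic permutations of the arguments is a projection; composed with
    [F12] it is [F11]. It splits the odd forms into the cyclic ones and those
    whose cyclic sum vanishes. On even forms, [F9] produces the even form of
    trace type having a prescribed trace; as the trace of [F9 F] is that of [F]
    ([trF_F9], the place where [n >= 2] enters) it is a projection whose kernel
    consists of the trace-free even forms. The trace of an odd form is zero,
    since [phi] is skew for the metric ([trF_odd]); hence [F9] only sees the
    even part.

    The four spaces are therefore cut out of [h F] by a parity together with a
    condition on the trace or on cyclic permutations ([mem_space9],
    [mem_space10], [mem_space11], [mem_space12]), from which everything
    follows. The operators recover the four terms of a sum
    ([components_of_sum]), which gives directness, and their values add up to
    [F] ([sum_of_components]). Even and odd forms are orthogonal because [L] is
    self-adjoint; a trace-type form pairs with [G] through the traces of [G]
    only; a cyclic form pairs with [G] through the cyclic sum of [G]. Finally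
    a structure-preserving map respects all these conditions. Adjoints, traces
    and their invariance all come from one identity on orthonormal bases,
    [frame_adjoint]. *)

(** * Arithmetic of trilinear forms *)

Section Forms.
Context (R : realType) (V : vectType R).
Implicit Types F : trilinear_form V.

Lemma formN1 F x y z : F (- x) y z = - F x y z.
Proof. by rewrite /form_value linearN !opp_lfunE. Qed.

Lemma formN2 F x y z : F x (- y) z = - F x y z.
Proof. by rewrite /form_value linearN opp_lfunE. Qed.

Lemma formN3 F x y z : F x y (- z) = - F x y z.
Proof. by rewrite /form_value linearN. Qed.

Lemma formD1 F u v y z : F (u + v) y z = F u y z + F v y z.
Proof. by rewrite /form_value linearD !add_lfunE. Qed.

Lemma formD2 F x u v z : F x (u + v) z = F x u z + F x v z.
Proof. by rewrite /form_value linearD add_lfunE. Qed.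

Lemma formD3 F x y u v : F x y (u + v) = F x y u + F x y v.
Proof. by rewrite /form_value linearD. Qed.

Lemma formZ1 F a u y z : F (a *: u) y z = a * F u y z.
Proof. by rewrite /form_value linearZ !scale_lfunE. Qed.

Lemma formZ2 F a x u z : F x (a *: u) z = a * F x u z.
Proof. by rewrite /form_value linearZ scale_lfunE. Qed.

Lemma formZ3 F a x y u : F x y (a *: u) = a * F x y u.
Proof. by rewrite /form_value linearZ. Qed.

Lemma form01 F y z : F 0 y z = 0.
Proof. by rewrite -(scale0r 0) formZ1 mul0r. Qed.

Lemma form02 F x z : F x 0 z = 0.
Proof. by rewrite -(scale0r 0) formZ2 mul0r. Qed.

Lemma form03 F x y : F x y 0 = 0.
Proof. by rewrite -(scale0r 0) formZ3 mul0r. Qed.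

Lemma formB (F G : trilinear_form V) x y z :
  (F - G : trilinear_form V) x y z = F x y z - G x y z.
Proof. by rewrite /form_value !(add_lfunE, opp_lfunE). Qed.

Lemma formD (F G : trilinear_form V) x y z :
  (F + G : trilinear_form V) x y z = F x y z + G x y z.
Proof. by rewrite /form_value !add_lfunE. Qed.

End Forms.

(** * Almost contact metric algebra and horizontal forms *)

Section Structure.
Context (R : realType) (V : vectType R) (M : almost_contact_metric V).
Local Notation phi := (phi M).
Local Notation xi := (xi M).
Local Notation eta := (Defs.eta M).
Local Notation g := (met M).
Implicit Types F G : trilinear_form V.

Lemma metC x y : g x y = g y x :> R.
Proof. by rewrite (hermC g) expr0 mul1r. Qed.

(** [phi (phi xi) = 0] makes [eta xi *: xi] equal to [xi]; pairing with the unit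
    vector [xi] gives the value. *)
Lemma eta_xi : eta xi = 1 :> R.
Proof.
have := phi2E M xi; rewrite phi_xi linear0 => /esym/eqP.
rewrite addrC subr_eq0 -[X in _ == X]scale1r => /eqP/(congr1 (g xi)).
by rewrite !linearZ /= met_xi !mulr1.
Qed.

Lemma met_xiE x : g x xi = eta x :> R.
Proof.
apply/eqP; rewrite -subr_eq0 -[X in _ - X]mulr1 -eta_xi -met_phi phi_xi.
by rewrite linear0r.
Qed.

(** On the kernel of [eta], [phi] is an isometry with square [-1], so its
    adjoint is its opposite. *)
Lemma phi_skew x y : g (phi x) y = - g x (phi y) :> R.
Proof.
have := met_phi M x (phi y); rewrite eta_phi mulr0 subr0 => <-.
rewrite phi2E linearD /= linearN linearZ /= met_xiE eta_phi.
by rewrite mulr0 addr0 opprK.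
Qed.

Lemma met_phi2 x y : g x (phi (phi y)) = eta x * eta y - g x y :> R.
Proof. by rewrite phi2E linearD /= linearN linearZ /= met_xiE mulrC addrC. Qed.

Lemma horE x : hor M x = x - eta x *: xi.
Proof. by rewrite /hor phi2E opprD opprK. Qed.

Lemma hor_xi : hor M xi = 0.
Proof. by rewrite horE eta_xi scale1r subrr. Qed.

Lemma met_hor x y : g (hor M x) (hor M y) = g x y - eta x * eta y :> R.
Proof.
have metNN u v : g (- u) (- v) = g u v :> R by rewrite linearNl linearNr opprK.
by rewrite /hor metNN met_phi !eta_phi mulr0 subr0 met_phi.
Qed.

(** The elements of [h F], see [horizontalP] and [mem_space_hF]. In this form
    the conditions can be checked slot by slot, and do not mention [hor]. *)
Definition horizontal (F : trilinear_form V) : Prop :=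
  [/\ forall y z, F xi y z = 0, forall x z, F x xi z = 0,
      forall x y z, F x y z = - F x z y
    & forall x y z, F x (phi y) z = F x y (phi z)].

Section Horizontal.
Context (F : trilinear_form V) (horF : horizontal F).

Lemma form_xi1 y z : F xi y z = 0.
Proof. by case: horF. Qed.

Lemma form_xi2 x z : F x xi z = 0.
Proof. by case: horF. Qed.

Lemma form_skew x y z : F x y z = - F x z y.
Proof. by case: horF. Qed.

Lemma form_xi3 x y : F x y xi = 0.
Proof. by rewrite form_skew form_xi2 oppr0. Qed.

Lemma form_phi23 x y z : F x (phi y) z = F x y (phi z).
Proof. by case: horF. Qed.

Lemma form_phi2_1 x y z : F (phi (phi x)) y z = - F x y z.
Proof. by rewrite phi2E formD1 formN1 formZ1 form_xi1 mulr0 addr0. Qed.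

Lemma form_phi2_2 x y z : F x (phi (phi y)) z = - F x y z.
Proof. by rewrite phi2E formD2 formN2 formZ2 form_xi2 mulr0 addr0. Qed.

Lemma form_phi2_3 x y z : F x y (phi (phi z)) = - F x y z.
Proof. by rewrite phi2E formD3 formN3 formZ3 form_xi3 mulr0 addr0. Qed.

Lemma form_hor1 x y z : F (hor M x) y z = F x y z.
Proof. by rewrite /hor formN1 form_phi2_1 opprK. Qed.

Lemma form_hor2 x y z : F x (hor M y) z = F x y z.
Proof. by rewrite /hor formN2 form_phi2_2 opprK. Qed.

Lemma form_hor3 x y z : F x y (hor M z) = F x y z.
Proof. by rewrite /hor formN3 form_phi2_3 opprK. Qed.

(** A normal form for values at arguments [x], [phi x]: [xi] and [phi^2] are
    eliminated, and a [phi] in the third slot goes to the second, so that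
    identities between horizontal forms become linear in the remaining
    values. *)
Definition phi_normE :=
  (form_xi1, form_xi2, form_xi3, @form01 R V, @form02 R V, @form03 R V,
   form_phi2_1, form_phi2_2, form_phi2_3, fun x y z => esym (form_phi23 x y z),
   eta_phi, phi_xi).

End Horizontal.

Lemma horizontalP F : horizontal F <-> F \in spaceF M /\ F = hF M F.
Proof.
split=> [horF|[/spaceFP FF Fh]].
  split; last first.
    by apply: formP => x y z; rewrite hFE form_hor1 ?form_hor2 ?form_hor3.
  apply/spaceFP => x y z; rewrite -(form_skew horF); split=> //.
  by rewrite (form_phi23 horF) form_phi2_3 // form_xi2 // form_xi3 //; ring.
have F1 y z : F xi y z = 0.
  by rewrite Fh hFE hor_xi form01.
have F2 x z : F x xi z = 0 by rewrite Fh hFE hor_xi form02.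
have sk x y z : F x y z = - F x z y by case: (FF x y z).
split=> // x y z.
have [_] := FF x (phi y) z; rewrite eta_phi [F x _ xi]sk F2 phi2E.
by rewrite formD2 formN2 formZ2 !F2; lra.
Qed.

(** The eigenspaces of the involution [L], for the eigenvalues [1] and [-1]. *)
Definition phi_even (F : trilinear_form V) : Prop :=
  forall x y z, F (phi x) (phi y) z = F x y z.

Definition phi_odd (F : trilinear_form V) : Prop :=
  forall x y z, F (phi x) (phi y) z = - F x y z.

Lemma even_phi12 F : horizontal F -> phi_even F ->
  forall x y z, F (phi x) y z = - F x (phi y) z.
Proof. by move=> horF eF x y z; rewrite -(eF x) form_phi2_2 // opprK. Qed.

Lemma form_phi_skew F : horizontal F ->
  forall x y z, F (phi x) (phi y) z = - F (phi x) (phi z) y.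
Proof. by move=> horF x y z; rewrite form_skew // form_phi23. Qed.

End Structure.

(** * Sums over an orthonormal basis *)

Section Frame.
Context (R : realType) (V : vectType R) (M : almost_contact_metric V).
Local Notation phi := (phi M).
Local Notation xi := (xi M).
Local Notation eta := (Defs.eta M).
Local Notation g := (met M).
Context (n : nat) (e : (n.*2.+1).-tuple V) (e_on : orthonormal_basis M e).
Implicit Types F G : trilinear_form V.

Lemma frame_met (i j : 'I_n.*2.+1) : g e`_i e`_j = (i == j)%:R :> R.
Proof.
case: e_on => _ /andP[/allP e1 e0].
have lt_met (s : seq V) (k l : nat) :
    pair_ortho_rec g s -> (k < l < size s)%N -> g s`_k s`_l = 0 :> R.
  elim: s k l => [|v s IH] [|k] [|l] //=.
  - by rewrite andbF.
  - by rewrite andbT => /andP[/allP sv _] ls; exact/eqP/sv/mem_nth.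
  - by move=> /andP[_ os]; exact: IH.
have [<-|] := eqVneq i j; first by apply/eqP/e1/mem_nth; rewrite size_tuple.
rewrite -val_eqE neq_ltn => /orP[] ij; last rewrite metC;
  by apply: lt_met; rewrite // ij size_tuple ltn_ord.
Qed.

Lemma frame_expand (l : V -> R) x :
  (forall a u v, l (a *: u + v) = a * l u + l v) ->
  l x = \sum_(i < n.*2.+1) g x e`_i * l e`_i.
Proof.
move=> ll; have lE := @linfun_linE _ V R^o l ll.
have [be _] := e_on; rewrite -[l x]lE.
have coordE i : coord e i x = g x e`_i.
  rewrite metC [in RHS](coord_basis be (memvf x)) linear_sum /=.
  rewrite (bigD1 i) //= linearZ /= frame_met eqxx mulr1 big1 ?addr0 // => j ji.
  by rewrite linearZ /= frame_met eq_sym (negPf ji) mulr0.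
rewrite {1}(coord_basis be (memvf x)) linear_sum /=; apply: eq_bigr => i _.
by rewrite linearZ /= lE coordE.
Qed.

Lemma frame_sum (l : V -> R) u :
  (forall a u v, l (a *: u + v) = a * l u + l v) ->
  \sum_(i < n.*2.+1) g e`_i u * l e`_i = l u.
Proof.
by move=> ll; rewrite [RHS]frame_expand //; apply: eq_bigr => i _; rewrite metC.
Qed.

(** The trace of a bilinear form composed with an endomorphism in one slot is
    that of its composition with the adjoint in the other. Taking [phi] and
    [- phi] gives self-adjointness of [L]; taking the inverse of an isometry
    and the isometry itself gives the invariance of traces. *)
Lemma frame_adjoint (a b : V -> V) (B : V -> V -> R) :
  (forall x y, g (a x) y = g x (b y) :> R) ->
  (forall y c u v, B (c *: u + v) y = c * B u y + B v y) ->
  (forall x c u v, B x (c *: u + v) = c * B x u + B x v) ->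
  \sum_(i < n.*2.+1) B (a e`_i) e`_i = \sum_(i < n.*2.+1) B e`_i (b e`_i).
Proof.
move=> ab Bl Br.
rewrite (eq_bigr (fun i : 'I_n.*2.+1 =>
    \sum_(j < n.*2.+1) g e`_i (b e`_j) * B e`_j e`_i)); last first.
  move=> i _; rewrite (@frame_expand (B^~ e`_i)) //.
  by apply: eq_bigr => j _; rewrite ab.
rewrite exchange_big; apply: eq_bigr => j _.
by rewrite (@frame_sum (B e`_j)).
Qed.

(** [F2 F = 0] read at [y = xi] gives [F x xi z = eta z * F x xi xi], and the
    right-hand side vanishes because [F] is skew. *)
Lemma mem_space_hF F : F \in space_hF M <-> horizontal M F.
Proof.
split=> [/(space_hFP M e) [FF F10 F20]|horF].
  have F1 y z : F xi y z = 0.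
    by have := F1E M F xi y z; rewrite F10 form0 eta_xi mul1r.
  have sk x y z : F x y z = - F x z y.
    by move/spaceFP: FF => /(_ x y z)[].
  have Fxx x : F x xi xi = 0 by have := sk x xi xi; lra.
  have F2 x z : F x xi z = 0.
    by have := F2E M F x xi z; rewrite F20 form0 eta_xi Fxx; lra.
  have F3 x y : F x y xi = 0 by rewrite sk F2 oppr0.
  apply/horizontalP; split=> //; apply: formP => x y z.
  rewrite hFE !horE !(formD1, formD2, formD3, formN1, formN2, formN3).
  by rewrite !(formZ1, formZ2, formZ3) !(F1, F2, F3); ring.
apply/(space_hFP M e _); split; first by case/horizontalP: horF.
  by apply: formP => x y z; rewrite F1E form_xi1 // form0 mulr0.
by apply: formP => x y z; rewrite F2E !form_xi2 // form0 !mulr0 subrr.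
Qed.

Lemma horizontalB F G :
  horizontal M F -> horizontal M G -> horizontal M (F - G).
Proof. by rewrite -!mem_space_hF; exact: rpredB. Qed.

(** * Traces and the four operators *)

Section Trace.
Context (F : trilinear_form V) (horF : horizontal M F).

Lemma trF_phi2 z : trF e F (phi (phi z)) = - trF e F z.
Proof.
by rewrite /trF -sumrN; apply: eq_bigr => i _; rewrite form_phi2_3.
Qed.

Lemma trF_xi : trF e F xi = 0.
Proof. by rewrite /trF big1 // => i _; rewrite form_xi3. Qed.

Lemma trF_phi_phi z :
  \sum_(i < n.*2.+1) F (phi e`_i) (phi e`_i) z = trF e F z.
Proof.
rewrite (@frame_adjoint phi (fun y => - phi y) (fun x y => F x (phi y) z)).
- by apply: eq_bigr => i _; rewrite linearN form_hor2.
- by move=> x y; rewrite phi_skew linearNr.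
- by move=> y c u v; rewrite form_l1.
- by move=> x c u v; rewrite linearP form_l2.
Qed.

(** Oddness changes the sign of the sum in [trF_phi_phi]. *)
Lemma trF_odd z : phi_odd M F -> trF e F z = 0.
Proof.
move=> oF; have : trF e F z = - trF e F z; last by lra.
by rewrite -[LHS]trF_phi_phi -sumrN; apply: eq_bigr => i _; exact: oF.
Qed.

End Trace.

Lemma trF0 F : trF e F 0 = 0.
Proof. by rewrite /trF big1 // => i _; rewrite form03. Qed.

(** Skewness is visible on the formula; [phi] passes from [y] to [z] because
    this exchanges the terms in [hor] with the terms in [phi]. *)
Lemma F9_horizontal F : horizontal M F -> horizontal M (F9 M e F).
Proof.
move=> horF; split=> *; rewrite !F9E !met_hor ?phi_xi ?(metC M xi) ?met_xiE
  ?linear0r ?eta_xi ?eta_phi ?trF_xi ?trF0 ?met_phi2 ?trF_phi2 //; ring.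
Qed.

Lemma F10_horizontal F : horizontal M F -> horizontal M (F10 M F).
Proof.
move=> horF; split=> *; rewrite !F10E ?(phi_normE horF); try ring.
by rewrite (form_skew horF) (form_phi_skew horF); ring.
Qed.

Lemma F12_horizontal F : horizontal M F -> horizontal M (F12 M F).
Proof.
move=> horF; split=> *; rewrite !F12E ?(phi_normE horF); try ring.
by rewrite (form_skew horF) (form_phi_skew horF); ring.
Qed.

Lemma F11_horizontal F : horizontal M F -> horizontal M (F11 M F).
Proof.
move=> horF; split=> [y z|x z|x y z|x y z]; rewrite !F11E ?(phi_normE horF).
- by ring.
- by ring.
- rewrite (form_skew horF x) (form_skew horF y) (form_skew horF z).
  rewrite (form_phi_skew horF x) (form_phi_skew horF y) (form_phi_skew horF z).
  ring.
- ring.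
Qed.

Lemma F9_even F : horizontal M F -> phi_even M (F9 M e F).
Proof.
move=> horF x y z; rewrite !F9E !met_hor !met_phi2 !trF_phi2 // !eta_phi.
by rewrite met_phi !phi_skew met_phi2; ring.
Qed.

Lemma F10_even F : horizontal M F -> phi_even M (F10 M F).
Proof. by move=> horF x y z; rewrite !F10E ?(phi_normE horF); ring. Qed.

Lemma F12_odd F : horizontal M F -> phi_odd M (F12 M F).
Proof. by move=> horF x y z; rewrite !F12E ?(phi_normE horF); ring. Qed.

Lemma F11_odd F : horizontal M F -> phi_odd M (F11 M F).
Proof. by move=> horF x y z; rewrite !F11E ?(phi_normE horF); ring. Qed.

Lemma F10_id F : phi_even M F -> F10 M F = F.
Proof. by move=> eF; apply: formP => x y z; rewrite F10E eF; field. Qed.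

Lemma F12_id F : phi_odd M F -> F12 M F = F.
Proof. by move=> oF; apply: formP => x y z; rewrite F12E oF; field. Qed.

Lemma F10_odd0 F : phi_odd M F -> F10 M F = 0.
Proof. by move=> oF; apply: formP => x y z; rewrite F10E oF form0; ring. Qed.

Lemma F12_even0 F : phi_even M F -> F12 M F = 0.
Proof. by move=> eF; apply: formP => x y z; rewrite F12E eF form0; ring. Qed.

Lemma F11_even0 F : phi_even M F -> F11 M F = 0.
Proof. by move=> eF; apply: formP => x y z; rewrite F11E !eF form0; ring. Qed.

Lemma F11_oddE F : phi_odd M F ->
  forall x y z, F11 M F x y z = 3^-1 * (F x y z + F y z x + F z x y).
Proof. by move=> oF x y z; rewrite F11E !oF; field. Qed.

Lemma F9_tr0 F : (forall z, trF e F z = 0) -> F9 M e F = 0.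
Proof. by move=> F0; apply: formP => x y z; rewrite F9E !F0 form0; ring. Qed.

Lemma F9_tr_eq F G : (forall z, trF e F z = trF e G z) -> F9 M e F = F9 M e G.
Proof. by move=> FG; apply: formP => x y z; rewrite !F9E !FG. Qed.

Lemma trFB F G z : trF e (F - G) z = trF e F z - trF e G z.
Proof.
by rewrite /trF -sumrB; apply: eq_bigr => i _; rewrite formB.
Qed.

Lemma trF_F10 F z : horizontal M F -> trF e (F10 M F) z = trF e F z.
Proof.
move=> horF; rewrite /trF; under eq_bigr do rewrite F10E.
by rewrite -mulr_sumr big_split /= trF_phi_phi // -/(trF e F z); field.
Qed.

Lemma trace_hor : \sum_(i < n.*2.+1) g (hor M e`_i) (hor M e`_i) = n.*2%:R :> R.
Proof.
under eq_bigr => i _ do rewrite met_hor frame_met eqxx -{1}met_xiE.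
rewrite sumrB sumr_const card_ord frame_sum ?eta_xi; last exact: eta_l.
by rewrite -[n.*2.+1]addn1 natrD addrK.
Qed.

Lemma trace_phi : \sum_(i < n.*2.+1) g e`_i (phi e`_i) = 0 :> R.
Proof.
rewrite big1 // => i _; have := phi_skew M e`_i e`_i.
rewrite metC; lra.
Qed.

(** Of the four terms of [F9], the first contributes [2 * n] times the trace,
    the second and the fourth subtract it once each, and the third vanishes as
    [phi] is trace-free: this accounts for the factor [2 * (n - 1)], which must
    be invertible. *)
Lemma trF_F9 F z : (2 <= n)%N -> horizontal M F ->
  trF e (F9 M e F) z = trF e F z.
Proof.
move=> n2 horF; rewrite {1}/trF; under eq_bigr do rewrite F9E.
have E2 : \sum_(i < n.*2.+1) g (hor M e`_i) (hor M z) * trF e F e`_i =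
    trF e F z.
  under eq_bigr => i _ do rewrite met_hor mulrBl -met_xiE mulrAC.
  rewrite sumrB -mulr_suml !(@frame_sum (trF e F)); try exact: trF_l.
  by rewrite trF_xi // mul0r subr0.
have E4 : \sum_(i < n.*2.+1) g e`_i (phi z) * trF e F (phi e`_i) = - trF e F z.
  rewrite (@frame_sum (fun x => trF e F (phi x))) ?trF_phi2 // => a u v.
  by rewrite phi_l trF_l.
rewrite -mulr_sumr !big_split /= !sumrN -!mulr_suml trace_hor trace_phi E2 E4.
have n1 : n%:R - 1 != 0 :> R.
  by rewrite subr_eq0 pnatr_eq1; case: (n) n2 => [|[]].
by rewrite -muln2 natrM; field.
Qed.

(** * The four subspaces and their direct sum *)

Section Decomposition.
Context (n2 : (2 <= n)%N).

(** [F9 F] depends on [F] through its trace only, which [F9] preserves. *)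
Lemma F9_idem F : horizontal M F -> F9 M e (F9 M e F) = F9 M e F.
Proof. by move=> horF; apply: F9_tr_eq => z; exact: trF_F9. Qed.

Lemma mem_space9 F :
  F \in space9 M e <-> [/\ horizontal M F, phi_even M F & F9 M e F = F].
Proof.
split=> [/space9P [FF Fh F9F]|[horF _ F9F]].
  have horF : horizontal M F by apply/horizontalP.
  by split=> //; rewrite F9F; exact: F9_even.
by apply/space9P; case/horizontalP: horF => FF Fh; split.
Qed.

(** [F10 - F9] is the projection of the even forms onto the kernel of the
    trace. *)
Lemma mem_space10 F :
  F \in space10 M e <->
  [/\ horizontal M F, phi_even M F & forall z, trF e F z = 0].
Proof.
split=> [/space10P [FF Fh F10F]|[horF eF tF]].
  have horF : horizontal M F by apply/horizontalP.
  split=> // [x y z|z]; last by rewrite F10F trFB trF_F10 // trF_F9 // subrr.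
  by rewrite F10F !formB F10_even ?F9_even.
apply/space10P; case/horizontalP: horF => FF Fh; split=> //.
by rewrite F10_id // F9_tr0 // subr0.
Qed.

(** On odd forms [F11] is the mean over the three cyclic permutations. *)
Lemma mem_space11 F :
  F \in space11 M <->
  [/\ horizontal M F, phi_odd M F & forall x y z, F y z x = F x y z].
Proof.
split=> [/(space11P M e) [FF Fh F11F]|[horF oF cF]].
  have horF : horizontal M F by apply/horizontalP.
  have oF : phi_odd M F by rewrite F11F; exact: F11_odd.
  by split=> // x y z; rewrite F11F !F11_oddE //; ring.
apply/(space11P M e); case/horizontalP: horF => FF Fh; split=> //.
by apply: formP => x y z; rewrite F11_oddE // (cF y z x) (cF x y z); field.
Qed.

Lemma mem_space12 F :
  F \in space12 M <->
  [/\ horizontal M F, phi_odd M F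
    & forall x y z, F x y z + F y z x + F z x y = 0].
Proof.
split=> [/(space12P M e) [FF Fh F12F]|[horF oF cF]].
  have horF : horizontal M F by apply/horizontalP.
  have oF : phi_odd M F.
    by move=> x y z; rewrite F12F !formB F12_odd ?F11_odd // opprB opprK addrC.
  split=> // x y z; have : F11 M F x y z = 0.
    have := congr1 (fun G : trilinear_form V => G x y z) F12F.
    by rewrite F12_id // formB; lra.
  by rewrite F11_oddE //; lra.
apply/(space12P M e); case/horizontalP: horF => FF Fh; split=> //.
apply: formP => x y z; rewrite F12_id // formB F11_oddE // cF; ring.
Qed.

(** Each operator acts as the identity or as zero on each of the four spaces:
    [F9] keeps only [G9], [F10] keeps [G9 + G10], [F11] keeps only [G11] and
    [F12] keeps [G11 + G12]. *)
Lemma components_of_sum (G9 G10 G11 G12 : trilinear_form V) :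
  G9 \in space9 M e -> G10 \in space10 M e ->
  G11 \in space11 M -> G12 \in space12 M ->
  let F : trilinear_form V := G9 + G10 + G11 + G12 in
  [/\ G9 = F9 M e F, G10 = F10 M F - F9 M e F,
      G11 = F11 M F & G12 = F12 M F - F11 M F].
Proof.
move=> /mem_space9[h9 e9 i9] /mem_space10[h10 e10 t10].
move=> /mem_space11[h11 o11 c11] /mem_space12[h12 o12 c12] F.
have opD (op : trilinear_form V -> trilinear_form V) :
    (forall a (A B : trilinear_form V), op (a *: A + B) = a *: op A + op B) ->
    op F = op G9 + op G10 + op G11 + op G12.
  move=> opl; have D A B : op (A + B) = op A + op B.
    by rewrite -[A]scale1r opl !scale1r.
  by rewrite !D.
have EF9 : F9 M e F = G9.
  rewrite (opD _ (F9_lin M e)) i9 !F9_tr0 ?addr0 // => z; exact: trF_odd.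
have EF10 : F10 M F = G9 + G10.
  rewrite (opD _ (F10_lin M e)) (F10_id e9) (F10_id e10).
  by rewrite (F10_odd0 o11) (F10_odd0 o12) !addr0.
have EF11 : F11 M F = G11.
  rewrite (opD _ (F11_lin M e)) (F11_even0 e9) (F11_even0 e10) !add0r.
  apply: formP => x y z.
  by rewrite formD !F11_oddE // c12 (c11 y z x) (c11 x y z); field.
have EF12 : F12 M F = G11 + G12.
  rewrite (opD _ (F12_lin M e)) (F12_even0 e9) (F12_even0 e10) !add0r.
  by rewrite (F12_id o11) (F12_id o12).
by rewrite EF9 EF10 EF11 EF12 ![_ + _ - _]addrC !addKr.
Qed.

Lemma F9_space9 F : horizontal M F -> F9 M e F \in space9 M e.
Proof.
move=> horF; apply/mem_space9; split.
- exact: F9_horizontal.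
- exact: F9_even.
- exact: F9_idem.
Qed.

Lemma F10B9_space10 F : horizontal M F -> F10 M F - F9 M e F \in space10 M e.
Proof.
move=> horF; apply/mem_space10; split=> [|x y z|z].
- exact: horizontalB (F10_horizontal horF) (F9_horizontal horF).
- by rewrite !formB F10_even ?F9_even.
- by rewrite trFB trF_F10 // trF_F9 // subrr.
Qed.

Lemma F11_space11 F : horizontal M F -> F11 M F \in space11 M.
Proof.
move=> horF; apply/mem_space11; split.
- exact: F11_horizontal.
- exact: F11_odd.
- by move=> x y z; rewrite !F11E; ring.
Qed.

Lemma F12B11_space12 F : horizontal M F -> F12 M F - F11 M F \in space12 M.
Proof.
move=> horF; apply/mem_space12; split=> [|x y z|x y z].
- exact: horizontalB (F12_horizontal horF) (F11_horizontal horF).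
- by rewrite !formB F12_odd ?F11_odd // opprB opprK addrC.
- by rewrite !formB !F12E !F11E; field.
Qed.

Lemma sum_of_components F :
  F9 M e F + (F10 M F - F9 M e F) + F11 M F + (F12 M F - F11 M F) = F.
Proof.
have F10_12 : F10 M F + F12 M F = F.
  by apply: formP => x y z; rewrite formD F10E F12E; field.
by rewrite subrKC -addrA subrKC.
Qed.

Lemma space_hF_sum :
  space_hF M = (space9 M e + space10 M e + space11 M + space12 M)%VS.
Proof.
apply/vspaceP => F; apply/idP/idP => [/mem_space_hF horF|].
  have <- := sum_of_components F; apply: memv_add (F12B11_space12 horF).
  by apply: memv_add (F11_space11 horF); apply: memv_add (F10B9_space10 horF);
     exact: F9_space9.
move=> /memv_addP[_ /memv_addP[_ /memv_addP[C C9 [D D10 ->]] [G G11 ->]]].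
move=> [H H12 ->].
by rewrite !rpredD //; apply/mem_space_hF;
  [case/mem_space9: C9 | case/mem_space10: D10
  |case/mem_space11: G11 | case/mem_space12: H12].
Qed.

(** A vector common to the sum of some of the spaces and to the next one has
    two decompositions; its component in the latter space, computed by the
    same operator, is both zero and itself. *)
Lemma space_hF_directv :
  directv (space9 M e + space10 M e + space11 M + space12 M).
Proof.
rewrite !directv_addE /= !directv_trivial /= -!andbA.
apply/and3P; split; rewrite -subv0; apply/subvP => F /memv_capP[].
- move=> F9 F10; rewrite memv0.
  have [+ _ _ _] := components_of_sum F9 (mem0v _) (mem0v _) (mem0v _).
  have [+ _ _ _] := components_of_sum (mem0v _) F10 (mem0v _) (mem0v _).
  by rewrite !(addr0, add0r) => <- ->.
- move=> /memv_addP[A A9 [B B10 ->]] F11; rewrite memv0.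
  have [_ _ + _] := components_of_sum A9 B10 (mem0v _) (mem0v _).
  have [_ _ + _] := components_of_sum (mem0v _) (mem0v _) F11 (mem0v _).
  by rewrite !(addr0, add0r) => E1 E2; rewrite E1 -E2.
- move=> /memv_addP[_ /memv_addP[A A9 [B B10 ->]] [C C11 ->]] F12.
  rewrite memv0.
  have [_ _ _ +] := components_of_sum A9 B10 C11 (mem0v _).
  have [_ _ _ +] := components_of_sum (mem0v _) (mem0v _) (mem0v _) F12.
  by rewrite !(addr0, add0r) => E1 E2; rewrite E1 -E2.
Qed.

(** * Orthogonality *)

(** [L] is self-adjoint, so its eigenspaces are orthogonal: each of the two
    occurrences of [phi] moves from [F] to [G] with a sign. *)
Lemma inner_even_odd F G : horizontal M F -> horizontal M G ->
  phi_even M F -> phi_odd M G -> inner e F G = 0.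
Proof.
move=> horF hG eF oG.
have adj x y : g (phi x) y = g x (- phi y) :> R by rewrite phi_skew linearNr.
suff : inner e F G = - inner e F G by lra.
(* The middle sum is reached from either side by moving one [phi]. *)
transitivity (- \sum_(i < n.*2.+1) \sum_(j < n.*2.+1) \sum_(k < n.*2.+1)
    F e`_i (phi e`_j) e`_k * G (phi e`_i) e`_j e`_k).
  rewrite /inner exchange_big [in RHS]exchange_big -sumrN.
  apply: eq_bigr => j _; rewrite exchange_big [in RHS]exchange_big -sumrN.
  apply: eq_bigr => k _ /=; under eq_bigr do rewrite -eF.
  rewrite (@frame_adjoint phi (fun y => - phi y)
    (fun x y => F x (phi e`_j) e`_k * G y e`_j e`_k)) //.
  - by rewrite -sumrN; apply: eq_bigr => i _; rewrite formN1 mulrN.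
  - by move=> y c u v; rewrite form_l1 mulrDl mulrA.
  - by move=> x c u v; rewrite form_l1 mulrDr mulrCA.
congr (- _); apply: eq_bigr => i _.
rewrite exchange_big [in RHS]exchange_big; apply: eq_bigr => k _ /=.
rewrite (@frame_adjoint phi (fun y => - phi y)
  (fun x y => F e`_i x e`_k * G (phi e`_i) y e`_k)) //.
- by apply: eq_bigr => j _; rewrite formN2 oG opprK.
- by move=> y c u v; rewrite form_l2 mulrDl mulrA.
- by move=> x c u v; rewrite form_l2 mulrDr mulrCA.
Qed.

(** Cyclically permuting the three summation indices shows that three times the
    product is the product of [F] with the cyclic sum of [G]. *)
Lemma inner_cyclic F G :
  (forall x y z, F y z x = F x y z) ->
  (forall x y z, G x y z + G y z x + G z x y = 0) -> inner e F G = 0.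
Proof.
move=> cF cG.
have rot (H : V -> V -> V -> R) :
    \sum_(i < n.*2.+1) \sum_(j < n.*2.+1) \sum_(k < n.*2.+1) H e`_i e`_j e`_k =
    \sum_(i < n.*2.+1) \sum_(j < n.*2.+1) \sum_(k < n.*2.+1) H e`_j e`_k e`_i.
  rewrite [RHS]exchange_big; apply: eq_bigr => i _; exact: exchange_big.
pose FG x y z := F x y z * G x y z.
have E1 := rot FG; have E2 := rot (fun x y z => FG y z x).
suff : inner e F G + inner e F G + inner e F G = 0 by lra.
rewrite /inner {2 3}E1 {2}E2 -!big_split big1 // => i _.
rewrite -!big_split big1 // => j _; rewrite -!big_split big1 //= => k _.
by rewrite /FG (cF e`_j e`_k e`_i) (cF e`_i e`_j e`_k) -!mulrDr cG mulr0.
Qed.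

(** As a function of its first argument a form of trace type is the metric dual
    of an explicit vector, so contracting that slot against another form only
    evaluates the latter at this vector. *)
Lemma F9_met F x y z : F9 M e F x y z =
  g x ((2 * (n%:R - 1))^-1 *:
    (trF e F z *: hor M y - trF e F y *: hor M z
     - trF e F (phi z) *: phi y + trF e F (phi y) *: phi z)).
Proof.
have gh u : g x (hor M u) = g (hor M x) (hor M u) :> R.
  by rewrite met_hor horE linearB /= linearZ /= met_xiE mulrC.
rewrite F9E linearZ /= linearD /= !linearB /= !linearZ /= !gh.
by congr (_ * _); ring.
Qed.

(** After contracting the first slot by [F9_met], each of the four terms
    contains a trace of [G], possibly twisted by [phi]; the twisted ones reduce
    to the plain one because [G] is even. *)
Lemma inner_F9_trace0 F G : horizontal M G -> phi_even M G ->
  (forall z, trF e G z = 0) -> inner e (F9 M e F) G = 0.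
Proof.
move=> hG eG tG; pose f := trF e F.
have slot1 y z : \sum_(i < n.*2.+1) F9 M e F e`_i y z * G e`_i y z =
    (2 * (n%:R - 1))^-1 * (f z * G y y z - f y * G z y z
      - f (phi z) * G (phi y) y z + f (phi y) * G (phi z) y z).
  under eq_bigr do rewrite F9_met.
  rewrite (@frame_sum (fun x => G x y z)) => [|a u v]; last exact: form_l1.
  by rewrite formZ1 !(formD1, formN1, formZ1) !form_phi2_1 // !opprK.
have t1 z : \sum_(j < n.*2.+1) G e`_j e`_j z = 0 by exact: tG.
have t2 y : \sum_(k < n.*2.+1) G e`_k y e`_k = 0.
  by under eq_bigr do rewrite (form_skew hG); rewrite sumrN t1 oppr0.
have t3 z : \sum_(j < n.*2.+1) G (phi e`_j) e`_j z = 0.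
  under eq_bigr do rewrite (even_phi12 hG eG) (form_phi23 hG).
  by rewrite sumrN t1 oppr0.
have t4 y : \sum_(k < n.*2.+1) G (phi e`_k) y e`_k = 0.
  by under eq_bigr do rewrite (form_skew hG); rewrite sumrN t3 oppr0.
rewrite /inner exchange_big.
under eq_bigr => j _ do (rewrite exchange_big; under eq_bigr do rewrite slot1).
under eq_bigr => j _ do rewrite -mulr_sumr !big_split /= !sumrN
  -!mulr_sumr t2 t4 !mulr0 addr0 subr0.
rewrite -mulr_sumr sumrB exchange_big.
rewrite [X in _ * (_ - X)]exchange_big !big1 ?subrr ?mulr0 // => k _ /=.
  by rewrite -mulr_sumr t3 mulr0.
by rewrite -mulr_sumr t1 mulr0.
Qed.

(** * Invariance under the structure group *)

Section Action.
Context (a : 'End(V)) (aP : preserves_structure M a).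
Local Notation b := (a^-1)%VF.

Lemma isoK x : b (a x) = x.
Proof. by case: aP => k _ _ _ _; exact: lker0_lfunK. Qed.

Lemma isoVK x : a (b x) = x.
Proof. by case: aP => k _ _ _ _; exact: lker0_lfunVK. Qed.

Lemma isoV_phi x : b (phi x) = phi (b x).
Proof. by case: aP => _ ap _ _ _; rewrite -{1}[x]isoVK -ap isoK. Qed.

Lemma isoV_xi : b xi = xi.
Proof. by case: aP => _ _ ax _ _; rewrite -{1}ax isoK. Qed.

Lemma isoV_eta x : eta (b x) = eta x.
Proof. by case: aP => _ _ _ ae _; rewrite -[in RHS](isoVK x) ae. Qed.

Lemma isoV_met x y : g (b x) (b y) = g x y :> R.
Proof.
by case: aP => _ _ _ _ am; rewrite -[in RHS](isoVK x) -[in RHS](isoVK y) am.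
Qed.

Lemma act_horizontal F : horizontal M F -> horizontal M (act a F).
Proof.
move=> horF; split=> *; rewrite !actE ?isoV_xi ?isoV_phi;
  [exact: (form_xi1 horF)|exact: (form_xi2 horF)
  |exact: (form_skew horF)|exact: (form_phi23 horF)].
Qed.

Lemma act_even F : phi_even M F -> phi_even M (act a F).
Proof. by move=> eF x y z; rewrite !actE !isoV_phi. Qed.

Lemma act_odd F : phi_odd M F -> phi_odd M (act a F).
Proof. by move=> oF x y z; rewrite !actE !isoV_phi. Qed.

(** The inverse of an isometry is its adjoint, so the two copies of it inside
    the trace cancel. *)
Lemma trF_act F z : trF e (act a F) z = trF e F (b z).
Proof.
rewrite /trF; under eq_bigr do rewrite actE.
rewrite (@frame_adjoint b a (fun x y => F x (b y) (b z))).
- by apply: eq_bigr => i _; rewrite isoK.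
- by move=> x y; rewrite -[y in LHS]isoK isoV_met.
- by move=> y c u v; rewrite form_l1.
- by move=> x c u v; rewrite linearP form_l2.
Qed.

Lemma F9_act F : F9 M e (act a F) = act a (F9 M e F).
Proof.
apply: formP => x y z; rewrite actE !F9E !trF_act !met_hor !isoV_met !isoV_eta.
by rewrite -!isoV_phi !isoV_met.
Qed.

End Action.

Lemma spaces_invariant :
  [/\ invariant_space M (space9 M e), invariant_space M (space10 M e),
      invariant_space M (space11 M) & invariant_space M (space12 M)].
Proof.
split=> a aP F.
- move=> /mem_space9[horF eF F9F]; apply/mem_space9; split.
  + exact: act_horizontal.
  + exact: act_even.
  + by rewrite F9_act // F9F.
- move=> /mem_space10[horF eF tF]; apply/mem_space10; split.
  + exact: act_horizontal.
  + exact: act_even.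
  + by move=> z; rewrite trF_act.
- move=> /mem_space11[horF oF cF]; apply/mem_space11; split.
  + exact: act_horizontal.
  + exact: act_odd.
  + by move=> x y z; rewrite !actE.
- move=> /mem_space12[horF oF cF]; apply/mem_space12; split.
  + exact: act_horizontal.
  + exact: act_odd.
  + by move=> x y z; rewrite !actE.
Qed.

End Decomposition.

End Frame.

Theorem proposition3 (R : realType) (n : nat) (V : vectType R)
    (M : almost_contact_metric V) (e : (n.*2.+1).-tuple V)
    (n_ge2 : (2 <= n)%N) (dimV : \dim {:V} = n.*2.+1)
    (e_orthonormal : orthonormal_basis M e) :
  (* F_1(F) = F_2(F) = 0 is equivalent to F = hF *)
  {in spaceF M, forall F, F \in space_hF M <-> F = hF M F} /\
  (* direct sum decomposition *)
  (space_hF M = space9 M e + space10 M e + space11 M + space12 M)%VS /\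
  directv (space9 M e + space10 M e + space11 M + space12 M) /\
  (* orthogonality *)
  [/\ orthogonal_spaces e (space9 M e) (space10 M e),
      orthogonal_spaces e (space9 M e) (space11 M)
    & orthogonal_spaces e (space9 M e) (space12 M)] /\
  [/\ orthogonal_spaces e (space10 M e) (space11 M),
      orthogonal_spaces e (space10 M e) (space12 M)
    & orthogonal_spaces e (space11 M) (space12 M)] /\
  (* invariance under U(n) x 1 *)
  [/\ invariant_space M (space9 M e), invariant_space M (space10 M e),
      invariant_space M (space11 M) & invariant_space M (space12 M)] /\
  (* components *)
  (forall F G9 G10 G11 G12 : trilinear_form V,
    G9 \in space9 M e -> G10 \in space10 M e ->
    G11 \in space11 M -> G12 \in space12 M ->
    F = G9 + G10 + G11 + G12 ->
    [/\ G9 = F9 M e F, G10 = F10 M F - F9 M e F,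
        G11 = F11 M F & G12 = F12 M F - F11 M F]).
Proof.
have ortho := inner_even_odd e_orthonormal.
split=> [F FF|].
  by rewrite (mem_space_hF M e) horizontalP; split=> [[]|].
split; first exact: space_hF_sum.
split; first exact: space_hF_directv.
split.
  split=> F G /(mem_space9 M e)[horF eF F9F].
  - move=> /(mem_space10 e_orthonormal n_ge2)[hG eG tG].
    by rewrite -F9F inner_F9_trace0.
  - by move=> /(mem_space11 M e)[hG oG _]; exact: ortho.
  - by move=> /(mem_space12 M e)[hG oG _]; exact: ortho.
split.
  split=> F G.
  - move=> /(mem_space10 e_orthonormal n_ge2)[horF eF _].
    by move=> /(mem_space11 M e)[hG oG _]; exact: ortho.
  - move=> /(mem_space10 e_orthonormal n_ge2)[horF eF _].
    by move=> /(mem_space12 M e)[hG oG _]; exact: ortho.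
  - move=> /(mem_space11 M e)[_ _ cF].
    by move=> /(mem_space12 M e)[_ _ cG]; exact: inner_cyclic.
split; first exact: spaces_invariant.
by move=> F G9 G10 G11 G12 ? ? ? ? ->; exact: components_of_sum.
Qed.
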